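(* Let $\mathbb{F}$ be a field, $q\in\mathbb{F}^\times$, and let $H=F_{(q)}$ be Radford's Hopf algebra. Then $H$ satisfies a nontrivial polynomial identity if and only if $q$ is a root of $1$. If $q$ is a primitive $n$th root of unity, then $H$ satisfies the standard identity $$S_{2n}(x_1,\ldots,x_{2n})=\sum_{\sigma\in\mathrm{Sym}(2n)}\mathrm{sgn}(\sigma)\,x_{\sigma(1)}\cdots x_{\sigma(2n)}=0,$$ and $2n$ is the minimum degree of nontrivial polynomial identities satisfied by $F_{(q)}$.
   Context: For a field $\mathbb{F}$ (arbitrary characteristic) and $q\in\mathbb{F}^\times$, $F_{(q)}$ is the unital associative $\mathbb{F}$-algebra generated by $a,a^{-1},x$ with relations $aa^{-1}=a^{-1}a=1$ and $ax=qxa$; it has $\mathbb{F}$-basis $\{x^ia^j: i\ge0,\ j\in\mathbb{Z}\}$. It is a Hopf algebra with $a$ group-like and $x$ skew-primitive, $\Delta(x)=x\otimes a+1\otimes x$, $S(x)=-xa^{-1}$. A nontrivial polynomial identity of an $\mathbb{F}$-algebra is a nonzero element $f$ of a free associative $\mathbb{F}$-algebra that vanishes under all substitutions of elements of the algebra. Here $q$ is a primitive $n$th root of unity if it has multiplicative order exactly $n$ in $\mathbb{F}^\times$. *)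

(* Defs.v *)
From HB Require Import structures.
From mathcomp Require Import all_boot all_order all_algebra all_fingroup.
From mathcomp Require Import ring_quotient generic_quotient boolp.
From mathcomp Require Import finmap monalg.

Set Implicit Arguments.
Unset Strict Implicit.
Unset Printing Implicit Defensive.

Import GRing.Theory.
Local Open Scope ring_scope.
Local Open Scope quotient_scope.

(* The monoid algebra of the free monoid on I, i.e. the unital free associative
   algebra on I. *)
Notation "{ 'freealg' F [ I ] }" := {malg F[{fmonom I}]}
  (at level 0, F at level 2, I at level 2, format "{ 'freealg'  F [ I ] }")
  : type_scope.

Section FreeAlgebra.
Context {F : fieldType} {I : choiceType}.

Definition fvar (i : I) : {freealg F[I]} := << fmu i >>.

Definition word_eval (A : algType F) (u : I -> A) (m : {fmonom I}) : A :=
  \prod_(i <- (m : seq I)) u i.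

Definition feval (A : algType F) (u : I -> A) : {freealg F[I]} -> A :=
  mmap (GRing.in_alg A) (word_eval u).

(* [mmeasure (@fdeg I) f] is 0 for f = 0 and 1 + (total degree of f) otherwise,
   so fdegree 0 = 0. *)
Definition fdegree (f : {freealg F[I]}) : nat :=
  (mmeasure (@fdeg I) f).-1.

Section Eval.
Variables (A : algType F) (u : I -> A).

Lemma word_eval_mmorphism : mmorphism (word_eval u).
Proof.
split=> [m1 m2|]; first by rewrite /word_eval fmM big_cat.
by rewrite /word_eval fm1 big_nil.
Qed.

HB.instance Definition _ := @isMultiplicative.Build _ _ (word_eval u)
  word_eval_mmorphism.

HB.instance Definition _ := GRing.Additive.copy (feval u)
  (mmap (GRing.in_alg A) (word_eval u)).

Lemma feval_is_monoid_morphism : monoid_morphism (feval u).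
Proof.
have [fM f1] : multiplicative (feval u); last by split.
apply: commr_mmap_is_multiplicative => g m m'; rewrite /GRing.comm /=.
by rewrite -scalerAl mul1r -scalerAr mulr1.
Qed.

HB.instance Definition _ := GRing.isMonoidMorphism.Build _ _ (feval u)
  feval_is_monoid_morphism.

Lemma feval_is_scalable : scalable (feval u).
Proof. by move=> c f; rewrite [LHS]mmapZ /= -scalerAl mul1r. Qed.

HB.instance Definition _ := GRing.isScalable.Build _ _ _ _ (feval u)
  feval_is_scalable.

Lemma feval_fvar i : feval u (fvar i) = u i.
Proof. by rewrite [LHS]mmapU /= scale1r mul1r /word_eval fmU big_seq1. Qed.

Lemma fevalB f g : feval u (f - g) = feval u f - feval u g.
Proof. exact: rmorphB. Qed.

Lemma fevalM f g : feval u (f * g) = feval u f * feval u g.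
Proof. exact: rmorphM. Qed.

Lemma feval1 : feval u 1 = 1.
Proof. exact: rmorph1. Qed.

End Eval.

Lemma freealg_scalerAr (c : F) (f g : {freealg F[I]}) :
  f * (c *: g) = c *: (f * g).
Proof.
rewrite !(malgMEw (fsubset_refl _) (msuppZ_le _ _)) malgME scaler_sumr.
apply: eq_bigr => k1 _; rewrite scaler_sumr; apply: eq_bigr => k2 _.
apply/malgP => k; rewrite [in RHS]mcoeffZ [in LHS]mcoeffU [in RHS]mcoeffU.
by rewrite [in LHS]mcoeffZ mulrnAr (mulrCA c).
Qed.

End FreeAlgebra.

(* I ranges over all sets of variables, finite or infinite. *)
Section PolynomialIdentity.
Context {F : fieldType}.

Definition polynomial_identity (A : algType F) (I : choiceType)
    (f : {freealg F[I]}) : Prop :=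
  forall u : I -> A, feval u f = 0.

Definition nontrivial_PI (A : algType F) (I : choiceType)
    (f : {freealg F[I]}) : Prop :=
  f != 0 /\ polynomial_identity A f.

Definition satisfies_nontrivial_PI (A : algType F) : Prop :=
  exists (I : choiceType) (f : {freealg F[I]}), nontrivial_PI A f.

Definition min_PI_degree (A : algType F) (d : nat) : Prop :=
  (exists (I : choiceType) (f : {freealg F[I]}),
     nontrivial_PI A f /\ fdegree f = d) /\
  (forall (I : choiceType) (f : {freealg F[I]}),
     nontrivial_PI A f -> (d <= fdegree f)%N).

Definition standard_poly (m : nat) : {freealg F['I_m]} :=
  \sum_(s : 'S_m) (-1) ^+ s *: \prod_(i < m) fvar (s i).

End PolynomialIdentity.

Inductive two_sided_ideal (R : nzRingType) (S : R -> Prop) : R -> Prop :=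
| TSI_gen r : S r -> two_sided_ideal S r
| TSI_zero : two_sided_ideal S 0
| TSI_add r s :
    two_sided_ideal S r -> two_sided_ideal S s -> two_sided_ideal S (r + s)
| TSI_mull r s : two_sided_ideal S s -> two_sided_ideal S (r * s)
| TSI_mulr r s : two_sided_ideal S r -> two_sided_ideal S (r * s).

Inductive radford_gen := Gen_a | Gen_ainv | Gen_x.

Definition radford_gen_encode (g : radford_gen) : nat :=
  match g with Gen_a => 0 | Gen_ainv => 1 | Gen_x => 2 end.

Definition radford_gen_decode (k : nat) : radford_gen :=
  match k with 0 => Gen_a | 1 => Gen_ainv | _ => Gen_x end.

Lemma radford_gen_encodeK : cancel radford_gen_encode radford_gen_decode.
Proof. by case. Qed.

HB.instance Definition _ := Countable.copy radford_gen
  (can_type radford_gen_encodeK).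


Section Radford.
Context {F : fieldType}.
Variable q : F.

Local Notation free := {freealg F[radford_gen]}.
Local Notation a := (fvar Gen_a : free).
Local Notation a' := (fvar Gen_ainv : free).
Local Notation x := (fvar Gen_x : free).

Definition radford_relator (f : free) : Prop :=
  [\/ f = a * a' - 1, f = a' * a - 1 | f = a * x - q *: (x * a)].

(* As a boolean predicate (by classical decidability), to form the quotient. *)
Definition radford_ideal : {pred free} :=
  fun f => `[< two_sided_ideal radford_relator f >].

Lemma radford_idealP f :
  reflect (two_sided_ideal radford_relator f) (f \in radford_ideal).
Proof. exact: asboolP. Qed.

Lemma radford_ideal_zmod_closed : zmod_closed radford_ideal.
Proof.
split=> [|f g /radford_idealP fI /radford_idealP gI]; apply/radford_idealP.
  exact: TSI_zero.
by apply: TSI_add => //; rewrite -mulN1r; apply: TSI_mull.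
Qed.

HB.instance Definition _ :=
  GRing.isZmodClosed.Build free radford_ideal radford_ideal_zmod_closed.

Lemma radford_idealMl f g : g \in radford_ideal -> f * g \in radford_ideal.
Proof. by move=> /radford_idealP gI; apply/radford_idealP/TSI_mull. Qed.

Lemma radford_idealMr f g : f \in radford_ideal -> f * g \in radford_ideal.
Proof. by move=> /radford_idealP fI; apply/radford_idealP/TSI_mulr. Qed.

Lemma radford_idealZ c f : f \in radford_ideal -> c *: f \in radford_ideal.
Proof. by move=> fI; rewrite -mul_malgC radford_idealMl. Qed.

Lemma feval_radford_ideal (A : algType F) (u : radford_gen -> A) :
    u Gen_a * u Gen_ainv = 1 -> u Gen_ainv * u Gen_a = 1 ->
    u Gen_a * u Gen_x = q *: (u Gen_x * u Gen_a) ->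
  forall f, f \in radford_ideal -> feval u f = 0.
Proof.
move=> uaa' ua'a uax f /radford_idealP; elim=> {f}.
- move=> f [] ->.
  + apply: etrans (fevalB _ _ _) _; rewrite feval1.
    by rewrite [X in X - 1]fevalM !feval_fvar uaa' subrr.
  + apply: etrans (fevalB _ _ _) _; rewrite feval1.
    by rewrite [X in X - 1]fevalM !feval_fvar ua'a subrr.
  + apply: etrans (fevalB _ _ _) _; apply/eqP; rewrite subr_eq0; apply/eqP.
    apply: etrans (fevalM _ _ _) _.
    apply: etrans _ (esym (feval_is_scalable _ _ _)).
    by rewrite [in RHS]fevalM !feval_fvar.
- exact: rmorph0.
- by move=> f g _ f0 _ g0; rewrite rmorphD /= f0 g0 addr0.
- by move=> f g _ g0; rewrite rmorphM /= g0 mulr0.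
- by move=> f g _ f0; rewrite rmorphM /= f0 mul0r.
Qed.

Lemma radford_ideal1 : 1 \notin radford_ideal.
Proof.
pose u g : F^o := if g is Gen_x then 0 else 1.
have ker_u : forall f, f \in radford_ideal -> feval u f = 0.
  by apply: feval_radford_ideal; rewrite /= ?mul1r ?mul0r ?scaler0.
by apply/negP => /ker_u/eqP; rewrite rmorph1 oner_eq0.
Qed.

(* The F-algebra F_(q) presented by generators a, a^-1, x and relations
   a a^-1 = a^-1 a = 1, a x = q x a. Only the algebra structure of the Hopf algebra
   is built: polynomial identities do not involve Delta, epsilon or S. *)
Definition radford : Type := Quotient.quot radford_ideal.

HB.instance Definition _ := GRing.Zmodule.on radford.
HB.instance Definition _ := EqQuotient.on radford.
HB.instance Definition _ := ZmodQuotient.on radford.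

Local Notation pi := (\pi_radford).

Lemma radford_eqP f g : reflect (pi f = pi g) (f - g \in radford_ideal).
Proof.
by rewrite (@Quotient.idealrBE free radford_ideal); apply: eqP.
Qed.

Definition radford_one : radford := pi 1.
Definition radford_mul (y z : radford) : radford := pi (repr y * repr z).
Definition radford_scale (c : F) (y : radford) : radford := pi (c *: repr y).

Lemma radford_repr f : f - repr (pi f) \in radford_ideal.
Proof. by apply/radford_eqP; rewrite reprK. Qed.

Lemma radford_piD f g : pi (f + g) = pi f + pi g.
Proof. exact: Quotient.pi_add. Qed.

Lemma radford_piN f : pi (- f) = - pi f.
Proof. exact: Quotient.pi_opp. Qed.

Lemma radford_pi0 : pi 0 = 0.
Proof. by rewrite -(subrr (0 : free)) radford_piD radford_piN subrr. Qed.

Lemma radford_piM f g : pi (f * g) = radford_mul (pi f) (pi g).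
Proof.
apply/radford_eqP.
have -> : f * g - repr (pi f) * repr (pi g) =
    f * (g - repr (pi g)) + (f - repr (pi f)) * repr (pi g).
  by rewrite mulrBr mulrBl addrA subrK.
apply: rpredD; first exact/radford_idealMl/radford_repr.
exact/radford_idealMr/radford_repr.
Qed.

Lemma radford_piZ c f : pi (c *: f) = radford_scale c (pi f).
Proof.
by apply/radford_eqP; rewrite -scalerBr; exact/radford_idealZ/radford_repr.
Qed.

Fact radford_mulA : associative radford_mul.
Proof.
move=> y z t; rewrite -[y]reprK -[z]reprK -[t]reprK.
move: (repr y) (repr z) (repr t) => f g h.
by rewrite -(radford_piM g h) -(radford_piM f g) -!radford_piM mulrA.
Qed.

Fact radford_mul1 : left_id radford_one radford_mul.
Proof. by move=> y; rewrite -[y]reprK -radford_piM mul1r. Qed.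

Fact radford_mulr1 : right_id radford_one radford_mul.
Proof. by move=> y; rewrite -[y]reprK -radford_piM mulr1. Qed.

Fact radford_mulDl : left_distributive radford_mul +%R.
Proof.
move=> y z t; rewrite -[y]reprK -[z]reprK -[t]reprK.
by rewrite -radford_piD -!radford_piM -radford_piD mulrDl.
Qed.

Fact radford_mulDr : right_distributive radford_mul +%R.
Proof.
move=> y z t; rewrite -[y]reprK -[z]reprK -[t]reprK.
by rewrite -radford_piD -!radford_piM -radford_piD mulrDr.
Qed.

Fact radford_one_neq0 : radford_one != 0.
Proof.
apply/eqP => e; have /negP := radford_ideal1; apply.
rewrite -[1]subr0; apply/radford_eqP.
by rewrite radford_pi0; exact: e.
Qed.

HB.instance Definition _ := GRing.Zmodule_isNzRing.Build radford
  radford_mulA radford_mul1 radford_mulr1 radford_mulDl radford_mulDr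
  radford_one_neq0.

Fact radford_scaleA c d y :
  radford_scale c (radford_scale d y) = radford_scale (c * d) y.
Proof. rewrite -[y]reprK; move: (repr y) => f.
by rewrite -(radford_piZ d f) -!radford_piZ scalerA. Qed.

Fact radford_scale1 : left_id 1 radford_scale.
Proof. by move=> y; rewrite -[y]reprK -radford_piZ scale1r. Qed.

Fact radford_scaleDr : right_distributive radford_scale +%R.
Proof.
move=> c y z; rewrite -[y]reprK -[z]reprK.
by rewrite -radford_piD -!radford_piZ scalerDr radford_piD.
Qed.

Fact radford_scaleDl y : {morph radford_scale^~ y : c d / c + d}.
Proof.
by move=> c d; rewrite -[y]reprK -!radford_piZ scalerDl radford_piD.
Qed.

HB.instance Definition _ := GRing.Zmodule_isLmodule.Build F radford
  radford_scaleA radford_scale1 radford_scaleDr radford_scaleDl.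

Fact radford_scaleAl c (y z : radford) : c *: (y * z) = (c *: y) * z.
Proof.
rewrite -[y]reprK -[z]reprK; move: (repr y) (repr z) => f g.
rewrite -[LHS]/(radford_scale c (radford_mul (pi f) (pi g))).
rewrite -[RHS]/(radford_mul (radford_scale c (pi f)) (pi g)).
by rewrite -(radford_piM f g) -!radford_piZ -radford_piM scalerAl.
Qed.

HB.instance Definition _ := GRing.Lmodule_isLalgebra.Build F radford
  radford_scaleAl.

Fact radford_scaleAr c (y z : radford) : c *: (y * z) = y * (c *: z).
Proof.
rewrite -[y]reprK -[z]reprK; move: (repr y) (repr z) => f g.
rewrite -[LHS]/(radford_scale c (radford_mul (pi f) (pi g))).
rewrite -[RHS]/(radford_mul (pi f) (radford_scale c (pi g))).
by rewrite -(radford_piM f g) -!radford_piZ -radford_piM freealg_scalerAr.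
Qed.

HB.instance Definition _ := GRing.Lalgebra_isAlgebra.Build F radford
  radford_scaleAr.

Definition radford_pi (f : free) : radford := pi f.

Lemma radford_pi_is_zmod_morphism : zmod_morphism radford_pi.
Proof. by move=> f g; rewrite /radford_pi radford_piD radford_piN. Qed.

HB.instance Definition _ := GRing.isZmodMorphism.Build free radford radford_pi
  radford_pi_is_zmod_morphism.

Lemma radford_pi_is_monoid_morphism : monoid_morphism radford_pi.
Proof. by split=> [|f g]; [exact: erefl | exact: radford_piM]. Qed.

HB.instance Definition _ := GRing.isMonoidMorphism.Build free radford radford_pi
  radford_pi_is_monoid_morphism.

Lemma radford_pi_is_scalable : scalable radford_pi.
Proof. by move=> c f; exact: radford_piZ. Qed.

HB.instance Definition _ := GRing.isScalable.Build F free radford *:%R radford_pi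
  radford_pi_is_scalable.

Lemma radford_pi_surj (y : radford) : exists f, radford_pi f = y.
Proof. by exists (repr y); apply: reprK. Qed.

Lemma radford_pi_eq0 f : (radford_pi f == 0) = (f \in radford_ideal).
Proof.
by rewrite -[f in RHS]subr0; apply/eqP/radford_eqP; rewrite radford_pi0.
Qed.

Definition radford_a : radford := radford_pi a.
Definition radford_ainv : radford := radford_pi a'.
Definition radford_x : radford := radford_pi x.

Lemma radford_aV : radford_a * radford_ainv = 1.
Proof.
apply/eqP; rewrite -subr_eq0 -rmorphM -(rmorph1 radford_pi) -rmorphB /=.
by rewrite radford_pi_eq0; apply/radford_idealP/TSI_gen; constructor 1.
Qed.

Lemma radford_Va : radford_ainv * radford_a = 1.
Proof.
apply/eqP; rewrite -subr_eq0 -rmorphM -(rmorph1 radford_pi) -rmorphB /=.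
by rewrite radford_pi_eq0; apply/radford_idealP/TSI_gen; constructor 2.
Qed.

Lemma radford_ax : radford_a * radford_x = q *: (radford_x * radford_a).
Proof.
apply/eqP; rewrite -subr_eq0 -!rmorphM -linearZ -rmorphB /=.
by rewrite radford_pi_eq0; apply/radford_idealP/TSI_gen; constructor 3.
Qed.

End Radford.

Arguments radford {F} q.

(* Main.v *)
(** Upper bound. The Amitsur-Levitzki theorem is proved after Rosset. If
    e_1, ..., e_2n anticommute and Y = sum_k e_k A_k, then Y^(2n) is
    S_2n(A_1, ..., A_2n) e_1 ... e_2n; the entries of Y^2 commute, and all powers
    of Y^2 have trace 0, so Y^2 is nilpotent of index at most n when the scalars
    have no torsion. The general case follows from integer matrix units by
    multilinearity. F_(q) is spanned by words in a, a^-1, x, and two words with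
    the same letters differ by a scalar that depends only on q. Hence S_2n of
    2n words is c(q) times a single word, and the factor c(q) vanishes because
    it also occurs in the clock and shift representation on n x n matrices,
    where every word is invertible.

    Lower bound. If 1, q, ..., q^(n-1) are distinct, the representation
    a -> diag(q^-i), x -> sum_i E_(i,i+1) has all the staircase matrices
    E_11, E_12, E_22, ..., E_nn in its image. Let w be a word of maximal degree
    d < 2n in f. Substituting for each variable the sum of the staircase
    matrices at its positions in w, restricted to a subset T of positions, and
    taking the alternating sum over T leaves only words of length d using each
    staircase matrix once. Their product is nonzero in a single order, so what
    remains is the coefficient of w. *)

From HB Require Import structures.
Require Import Defs.
From mathcomp Require Import all_boot all_order all_algebra all_fingroup.
From mathcomp Require Import zify boolp finmap monalg generic_quotient.

Set Implicit Arguments.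
Unset Strict Implicit.
Unset Printing Implicit Defensive.

Import GRing.Theory.
Local Open Scope ring_scope.

(** * Nilpotency from vanishing traces *)

Lemma deriv_prod (R : comNzRingType) (n : nat) (F : 'I_n -> {poly R}) :
  (\prod_i F i)^`() = \sum_i \prod_j (if j == i then (F j)^`() else F j).
Proof.
elim: n F => [|n IHn] F; first by rewrite !big_ord0 -polyC1 derivC.
rewrite !big_ord_recl derivM IHn mulr_sumr /=; congr (_ + _).
by apply: eq_bigr => i _; rewrite big_ord_recl.
Qed.

(** The product rule in each term of the Leibniz expansion, regrouped by the differentiated factor,
    differentiates one row at a time. *)
Lemma deriv_det (R : comNzRingType) (n : nat) (M : 'M[{poly R}]_n) :
  (\det M)^`() =
    \sum_i \det (\matrix_(j, k) if j == i then (M j k)^`() else M j k).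
Proof.
rewrite /determinant exchange_big raddf_sum; apply: eq_bigr => s _ /=.
have -> : ((-1) ^+ s * \prod_i M i (s i))^`() =
    (-1) ^+ s * (\prod_i M i (s i))^`().
  by rewrite !mulr_sign; case: (odd_perm s); rewrite // derivN.
rewrite deriv_prod mulr_sumr; apply: eq_bigr => i _; congr (_ * _).
by apply: eq_bigr => j _; rewrite mxE.
Qed.

(** Row [i] of [X - A] differentiates to the [i]th unit row, which leaves the [(i, i)] cofactor. *)
Lemma deriv_char_poly (R : comNzRingType) (n : nat) (A : 'M[R]_n) :
  (char_poly A)^`() = \tr (\adj (char_poly_mx A)).
Proof.
rewrite deriv_det /mxtrace; apply: eq_bigr => i _.
rewrite (expand_det_row _ i) (bigD1 i) //= big1 ?addr0 => [|j ji].
  rewrite !mxE eqxx mulr1n derivD derivX derivN derivC subr0 mul1r.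
  rewrite /cofactor; congr (_ * \det _); apply/matrixP => j k.
  by rewrite !mxE eq_sym (negPf (neq_lift _ _)).
by rewrite !mxE eqxx eq_sym (negPf ji) sub0r derivN derivC oppr0 mul0r.
Qed.

Definition torsion_free (V : zmodType) :=
  forall (v : V) (n : nat), v *+ n.+1 = 0 -> v = 0.

(** Newton's identities in division-free form: vanishing traces kill every coefficient of
    [char_poly A] below the leading one, and Cayley-Hamilton concludes. *)
Lemma nilpotent_of_tr0 (R : comNzRingType) (n : nat) (A : 'M[R]_n.+1) :
  torsion_free R -> (forall k, \tr (A ^+ k.+1) = 0) -> A ^+ n.+1 = 0.
Proof.
move=> tfR trA; pose p : {poly R} := char_poly A.
pose B k := map_mx (coefp k) (\adj (char_poly_mx A)).
have sz_p : size p = n.+2 by rewrite size_char_poly.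
(* B k is the coefficient of X^k in the adjugate of X - A. *)
have BE k : B k = A * B k.+1 + (p`_k.+1)%:M.
  have /(congr1 (map_mx (coefp k.+1))) := mul_mx_adj (char_poly_mx A).
  rewrite -/(char_poly A) -/p => E; apply/matrixP => i j.
  move/matrixP/(_ i j): E; rewrite !mxE /= coef_sum.
  rewrite (eq_bigr (fun l => (i == l)%:R * B k l j - A i l * B k.+1 l j));
    last first.
    move=> l _; rewrite !mxE /= mulrBl coefB coefCM -mulr_natl.
    by case: eqP => _ /=; rewrite ?mul1r ?mul0r ?coef0 ?coefXM.
  rewrite sumrB (bigD1 i) //= eqxx mul1r big1 ?addr0; last first.
    by move=> l /negPf li; rewrite eq_sym li mul0r.
  by rewrite coefMn => /eqP; rewrite subr_eq addrC => /eqP <-; rewrite !mxE.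
have [m Bm] : exists m, forall k, (m <= k)%N -> B k = 0.
  exists (\max_i \max_j size (\adj (char_poly_mx A) i j)) => k lek.
  apply/matrixP => i j; rewrite mxE [RHS]mxE /= nth_default //.
  apply: leq_trans _ lek; apply: leq_trans (leq_bigmax i).
  exact: (leq_bigmax j).
(* Descending induction on [k], starting where [B k = 0]; the scalar term of [BE] contributes a
   multiple of the trace of a power of [A]. *)
have trAB k j : \tr (A ^+ j.+1 * B k) = 0.
  have [d] := ubnP (m - k); elim: d k j => // d IHd k j dk.
  have [/Bm->|km] := leqP m k; first by rewrite mulr0 mxtrace0.
  rewrite BE mulrDr mxtraceD mulrA -exprSr IHd ?add0r; last lia.
  by rewrite -[_ * _]/(_ *m _) scalar_mxC mul_scalar_mx mxtraceZ trA mulr0.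
have trB k : \tr (B k) = p`_k.+1 *+ n.+1.
  by rewrite BE mxtraceD -{1}[A]expr1 trAB add0r mxtrace_scalar.
(* Compare the coefficients of X^k in (char_poly A)^`() = \tr (\adj (X - A)):
   (k + 1) c_(k+1) = (n + 1) c_(k+1). *)
have p_eq0 k : (k.+1 < n.+1)%N -> p`_k.+1 = 0.
  move=> ltkn; have : (p^`())`_k = p`_k.+1 *+ n.+1.
    rewrite deriv_char_poly /mxtrace coef_sum -trB.
    by apply: eq_bigr => i _; rewrite [RHS]mxE.
  rewrite coef_deriv.
  move/eqP; rewrite eq_sym -subr_eq0 -mulrnBr; last lia.
  move/eqP; have -> : (n.+1 - k.+1 = (n - k.+1).+1)%N by lia.
  exact: tfR.
have pE : p = 'X^(n.+1) + (p`_0)%:P.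
  apply/polyP => [[|k]]; rewrite coefD coefXn coefC /= ?add0r ?addr0 //.
  case: (ltngtP k.+1 n.+1) => [/p_eq0->|gtk|[->]] //.
    by rewrite nth_default ?sz_p.
  by have /monicP := char_poly_monic A; rewrite lead_coefE sz_p.
have Ap : A ^+ n.+1 + (p`_0)%:M = 0.
  have := Cayley_Hamilton A.
  by rewrite -/p pE rmorphD rmorphXn /= horner_mx_X horner_mx_C -pE.
(* The trace of [Ap] reads [(n + 1) c_0 = 0], which removes the constant coefficient. *)
have := congr1 mxtrace Ap; rewrite mxtraceD trA mxtrace_scalar mxtrace0 add0r.
by move=> /tfR p00; move: Ap; rewrite p00 rmorph0 addr0.
Qed.

(** * The Amitsur-Levitzki theorem *)

Section Anticommuting.
Variables (L : nzRingType) (m : nat) (e : 'I_m -> L).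
Hypothesis e_anti : forall i j, e i * e j = - (e j * e i).

Lemma anti_prodr (r : seq 'I_m) x :
    (forall i, x * e i = - (e i * x)) ->
  x * (\prod_(i <- r) e i) = (-1) ^+ size r * (\prod_(i <- r) e i * x).
Proof.
move=> xe; elim: r => [|i r IHr]; first by rewrite !big_nil mul1r mulr1 mul1r.
rewrite !big_cons mulrA xe mulNr -[e i * x * _]mulrA IHr /= exprS mulN1r mulNr.
by rewrite -signr_odd !mulr_sign; case: odd; rewrite ?mulrN ?mulrA.
Qed.

(** Moving [e i] or [e j] across [r2] costs the same sign on both sides; exchanging the two
    neighbours then gives the minus. *)
Lemma anti_prod_swap (r1 r2 r3 : seq 'I_m) i j :
  \prod_(k <- r1 ++ i :: r2 ++ j :: r3) e k =
  - \prod_(k <- r1 ++ j :: r2 ++ i :: r3) e k.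
Proof.
rewrite !(big_cat, big_cons) /= -mulrN; congr (_ * _).
rewrite !mulrA -mulNr; congr (_ * _).
rewrite !anti_prodr // -!mulrA e_anti !mulrN -mulrN; congr (_ * - _).
Qed.

Lemma anti_prod_tperm i j : i != j ->
  \prod_k e (tperm i j k) = - \prod_k e k.
Proof.
have swap (r1 r2 r3 : seq 'I_m) (k l : 'I_m) :
    uniq (r1 ++ k :: r2 ++ l :: r3) ->
  \prod_(x <- r1 ++ k :: r2 ++ l :: r3) e (tperm k l x) =
  - \prod_(x <- r1 ++ k :: r2 ++ l :: r3) e x.
  rewrite anti_prod_swap opprK uniq_catC => rU.
  have [kr1 lr1]: k \notin r1 /\ l \notin r1.
    move: rU; rewrite cat_uniq => /and3P[_ /hasPn r1U _].
    by split; apply/negP => /r1U; rewrite /= !(mem_cat, inE) eqxx ?orbT.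
  move: rU; rewrite /= !(cat_uniq, cons_uniq, mem_cat, inE) /= !negb_or => rU.
  have fixed r : k \notin r -> l \notin r ->
      \prod_(x <- r) e (tperm k l x) = \prod_(x <- r) e x.
    move=> kr lr; apply: eq_big_seq => x xr; rewrite tpermD //.
      by apply: contraNneq kr => ->.
    by apply: contraNneq lr => ->.
  rewrite !(big_cat, big_cons) /= tpermL tpermR.
  rewrite !fixed //;
    by apply: contraTT rU => /negbNE ->; rewrite /= ?(andbF, andFb).
have ordered (r : seq 'I_m) : uniq r -> i \in r -> j \in r -> forall ij : i != j,
    \prod_(x <- r) e (tperm i j x) = - \prod_(x <- r) e x.
  move=> Ur ir; case/splitPr: ir Ur => r1 r2 Ur.
  rewrite mem_cat inE orbA orbAC => /orP[/orP[]|/eqP->]; last by rewrite eqxx.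
    move=> jr ij; case/splitPr: jr Ur => r3 r4; rewrite -catA tpermC.
    exact: swap.
  by move=> jr ij; case/splitPr: jr Ur => r3 r4; exact: swap.
by apply: ordered; rewrite ?index_enum_uniq ?mem_index_enum.
Qed.

End Anticommuting.

(** Induction on a decomposition of [s] into transpositions: the reindexed family [e (u k)] still
    anticommutes, so each transposition contributes one sign. *)
Lemma anti_prod_perm (L : nzRingType) (m : nat) (e : 'I_m -> L) (s : 'S_m) :
    (forall i j, e i * e j = - (e j * e i)) ->
  \prod_i e (s i) = (-1) ^+ s * \prod_i e i.
Proof.
move=> e_anti; have [ts -> dts] := prod_tpermP s; rewrite odd_perm_prod //.
elim: ts dts => [_|[i j] ts IHts /= /andP[ij dts]].
  by rewrite big_nil mul1r; apply: eq_bigr => i _; rewrite perm1.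
rewrite big_cons; set u := (\prod_(t <- ts) tperm t.1 t.2)%g in IHts *.
under eq_bigr do rewrite permM /=.
rewrite (@anti_prod_tperm _ _ (fun k => e (u k))) // IHts //.
by rewrite !mulr_sign; case: odd => //=; rewrite opprK.
Qed.

(* Jordan-Wigner: from e_1, ..., e_m one gets m + 1 generators diag(e_i, - e_i)
   and E_12, over 2 x 2 matrices. *)
Lemma grassmann_exists (m : nat) :
  exists (L : nzRingType) (e : 'I_m -> L),
    [/\ torsion_free L, forall i j, e i * e j = - (e j * e i)
      & \prod_i e i != 0].
Proof.
elim: m => [|m [L [e [tfL eC e0]]]].
  exists int, (fun=> 0); split=> [v n /eqP|[]//|].
    by rewrite Num.Theory.mulrn_eq0 => /orP[|/eqP].
  by rewrite big_ord0 oner_eq0.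
pose d (x : L) : 'M[L]_2 :=
  \matrix_(i, j) if i == j then (if i == 0 then x else - x) else 0.
pose N : 'M[L]_2 := \matrix_(i, j) ((i == 0) && (j == 1))%:R.
have dd x y : d x * d y = (x * y)%:M.
  apply/matrixP => i j; rewrite !mxE (bigD1 i) //= big1 ?addr0 => [|k ki].
    by rewrite !mxE eqxx; case: eqP => _; case: eqP; rewrite ?mulr0 ?mulrNN.
  by rewrite !mxE eq_sym (negPf ki) mul0r.
have dN x : d x * N = x *: N.
  apply/matrixP => i j; rewrite !mxE (bigD1 i) //= big1 ?addr0 => [|k ki].
    by rewrite !mxE eqxx; case: eqP => _ //=; rewrite !mulr0.
  by rewrite !mxE eq_sym (negPf ki) mul0r.
have Nd x : N * d x = - (x *: N).
  apply/matrixP => i j; rewrite !mxE (bigD1 j) //= big1 ?addr0 => [|k ki].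
    rewrite !mxE eqxx; case: eqP => _ /=; last by rewrite mul0r mulr0 oppr0.
    case: eqP => [->|_] /=; last by rewrite mul0r mulr0 oppr0.
    by rewrite mul1r mulr1.
  by rewrite !mxE (negPf ki) mulr0.
have NN : N * N = 0.
  apply/matrixP => i j; rewrite !mxE big1 // => k _; rewrite !mxE.
  by case: (eqVneq k 1) => [->|_]; rewrite /= ?andbF ?mul0r ?mulr0.
have dprod (r : seq 'I_m) :
    (\prod_(i <- r) d (e i)) * N = (\prod_(i <- r) e i) *: N.
  elim: r => [|i r IHr]; first by rewrite !big_nil mul1r scale1r.
  by rewrite !big_cons -mulrA IHr -dN mulrA dd; apply: mul_scalar_mx.
have tfM : torsion_free 'M[L]_2.
  move=> v n /matrixP vn; apply/matrixP => i j; rewrite mxE.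
  by apply: (tfL _ n); have := vn i j; rewrite mulmxnE mxE.
(* [N] gets the last index, so that [dprod] turns the product of all generators into a nonzero
   multiple of [N]. *)
pose gen (i : 'I_m.+1) : 'M[L]_2 :=
  if unlift ord_max i is Some j then d (e j) else N.
exists 'M[L]_2; exists gen; rewrite /gen.
split=> // [i j|].
- case: unliftP => [i' _|_]; case: unliftP => [j' _|_].
  + by rewrite !dd eC raddfN.
  + by rewrite dN Nd opprK.
  + by rewrite dN Nd.
  + by rewrite NN oppr0.
- rewrite big_ord_recr /= unlift_none.
  under eq_bigr => i _.
    have -> : widen_ord (leqnSn m) i = lift ord_max i.
      by apply: val_inj; rewrite /= /bump leqNgt ltn_ord.
    rewrite liftK; over.
  rewrite dprod; apply: contraNneq e0 => /matrixP/(_ 0 1).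
  by rewrite !mxE /= mulr1 => ->.
Qed.

Section CentreOfCentralizer.
Variables (L : nzRingType) (E : L -> Prop).

Definition centralizes (x : L) := forall y, E y -> x * y = y * x.

(* The centre of the centralizer is commutative for every E; it contains E as
   soon as the elements of E commute pairwise. *)
Definition centralizer_centre : {pred L} :=
  fun x => `[< centralizes x /\ forall y, centralizes y -> x * y = y * x >].

Lemma centralizer_centreP x :
  reflect (centralizes x /\ forall y, centralizes y -> x * y = y * x)
          (x \in centralizer_centre).
Proof. exact: asboolP. Qed.

Lemma centralizer_centre_subring : subring_closed centralizer_centre.
Proof.
split.
- by apply/centralizer_centreP; split=> y _; rewrite mul1r mulr1.
- move=> x z /centralizer_centreP[xE xC] /centralizer_centreP[zE zC].
  apply/centralizer_centreP; split=> y yP; rewrite mulrBl mulrBr.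
    by rewrite xE ?zE.
  by rewrite xC ?zC.
- move=> x z /centralizer_centreP[xE xC] /centralizer_centreP[zE zC].
  apply/centralizer_centreP; split=> y yP; rewrite -mulrA.
    by rewrite zE ?mulrA ?xE.
  by rewrite zC ?mulrA ?xC.
Qed.

HB.instance Definition _ :=
  GRing.isSubringClosed.Build L centralizer_centre centralizer_centre_subring.

Record cent_centre := CentCentre {
  cent_centre_val : L; _ : cent_centre_val \in centralizer_centre }.

HB.instance Definition _ := [isSub for cent_centre_val].
HB.instance Definition _ := [Choice of cent_centre by <:].
HB.instance Definition _ := [SubChoice_isSubNzRing of cent_centre by <:].

Lemma cent_centre_mulC : commutative (@GRing.mul cent_centre).
Proof.
move=> [x xP] [y yP]; apply: val_inj; rewrite !rmorphM /=.
case/centralizer_centreP: xP => _; apply; by case/centralizer_centreP: yP.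
Qed.

HB.instance Definition _ :=
  GRing.PzRing_hasCommutativeMul.Build cent_centre cent_centre_mulC.

End CentreOfCentralizer.

(** The value of the standard polynomial in any ring, so that integer matrices, which form no
    algebra over a field, are covered. *)
Definition standard_sum (R : nzRingType) (m : nat) (y : 'I_m -> R) : R :=
  \sum_(s : 'S_m) (-1) ^+ s * \prod_i y (s i).

Lemma standard_sum_morph (R S : nzRingType) (f : {rmorphism R -> S}) m y :
  standard_sum (fun i : 'I_m => f (y i)) = f (standard_sum y).
Proof.
rewrite rmorph_sum; apply: eq_bigr => s _.
by rewrite rmorphM rmorph_sign rmorph_prod.
Qed.

Lemma prodM_comm (R : nzRingType) (I : Type) (r : seq I) (x y : I -> R) :
    (forall i j, y i * x j = x j * y i) ->
  \prod_(i <- r) (x i * y i) = (\prod_(i <- r) x i) * \prod_(i <- r) y i.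
Proof.
move=> yx; elim: r => [|i r IHr]; first by rewrite !big_nil mulr1.
rewrite !big_cons IHr -!mulrA; congr (_ * _); rewrite !mulrA; congr (_ * _).
elim: r {IHr} => [|j r IHr]; first by rewrite !big_nil mulr1 mul1r.
by rewrite !big_cons mulrA yx -!mulrA IHr.
Qed.

Lemma torsion_free_mulrz (V : zmodType) (v : V) (z : int) :
  torsion_free V -> v != 0 -> v *~ z = 0 -> z = 0.
Proof.
move=> tfV v0; case: z => [[|k] //|k] /eqP; rewrite ?NegzE ?mulrNz ?oppr_eq0.
  by rewrite -pmulrn => /eqP/tfV/eqP; rewrite (negPf v0).
by rewrite -pmulrn => /eqP/tfV/eqP; rewrite (negPf v0).
Qed.

(** Integers are central in every ring; hence integer matrices commute with scalar matrices even
    over a noncommutative [L]. *)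
Lemma scalar_intmxC (L : nzRingType) (n : nat) (c : L) (M : 'M[int]_n.+1) :
  c%:M * map_mx intr M = map_mx intr M * c%:M.
Proof.
apply/matrixP => i j; rewrite !mxE (bigD1 i) //= big1 => [|l li]; last first.
  by rewrite !mxE eq_sym (negPf li) mul0r.
rewrite addr0 (bigD1 j) //= big1 => [|l lj]; last first.
  by rewrite !mxE (negPf lj) mulr0.
by rewrite addr0 !mxE !eqxx commr_int.
Qed.

Section Rosset.
Variables (L : nzRingType) (m n : nat) (e : 'I_m -> L).
Variable A : 'I_m -> 'M[int]_n.+1.
Hypothesis tfL : torsion_free L.
Hypothesis e_anti : forall i j, e i * e j = - (e j * e i).

Let Y : 'M[L]_n.+1 := \sum_k map_mx intr (A k) * (e k)%:M.

Let YE i j : Y i j = \sum_k e k *~ A k i j.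
Proof.
rewrite summxE; apply: eq_bigr => k _.
rewrite mxE (bigD1 j) //= big1 => [|l lj].
  by rewrite !mxE eqxx addr0 mulr1n mulrzl.
by rewrite !mxE (negPf lj) mulr0.
Qed.

(** Expanding the power gives one term for each map from ['I_m] to itself; a repeated index kills
    the term, and a permutation contributes its sign. *)
Lemma rosset_pow : Y ^+ m =
  map_mx intr (standard_sum A) * (\prod_k e k)%:M.
Proof.
rewrite -{1}(card_ord m) -prodr_const bigA_distr_bigA /=.
under eq_bigr => f _.
  rewrite prodM_comm; last first.
    by move=> i j; apply: scalar_intmxC.
  over.
rewrite (bigID (fun f : {ffun 'I_m -> 'I_m} => injectiveb f)) /= addrC.
rewrite big1 ?add0r => [|f /injectivePn[a [b ab fab]]]; last first.
  suff -> : \prod_l (e (f l))%:M = 0 :> 'M[L]_n.+1 by rewrite mulr0.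
  rewrite -(rmorph_prod (@scalar_mx L n.+1)) /=.
  suff -> : \prod_l e (f l) = 0 by rewrite raddf0.
  (* Transposing [a] and [b] both fixes and negates the product, so its double is 0. *)
  apply: (tfL (n := 1)); apply/eqP; rewrite mulr2n addr_eq0; apply/eqP.
  rewrite -(@anti_prod_tperm _ _ (fun l => e (f l)) _ _ _ ab) //.
  apply: eq_bigr => l _.
  by case: tpermP => // ->; rewrite fab.
rewrite (reindex (@pval _)) /=; last first.
  pose in_Sn := insubd (1%g : 'S_m).
  by exists in_Sn => /= f Uf; first apply: val_inj; apply: insubdK.
rewrite -standard_sum_morph /standard_sum mulr_suml.
apply: eq_big => [s|s _]; first exact: (valP s).
rewrite -(rmorph_prod (@scalar_mx L n.+1)) /=.
rewrite (eq_bigr (fun l => e (s l))); last first.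
  by move=> l _; rewrite -pvalE.
rewrite anti_prod_perm // (eq_bigr (fun l => map_mx intr (A (s l)))); last first.
  by move=> l _; rewrite -pvalE.
by rewrite !mulr_sign; case: odd_perm; rewrite // raddfN mulrN mulNr.
Qed.

(** An entry of [Y ^+ k] is a sum of products of [k] entries of [Y], and [y] changes sign past each
    of them. *)
Lemma anti_pow_entry (y : L) k i j :
    (forall p r, y * Y p r = - (Y p r * y)) ->
  y * (Y ^+ k) i j = (-1) ^+ k * ((Y ^+ k) i j * y).
Proof.
move=> yY; elim: k j => [|k IHk] j.
  by rewrite !expr0 mul1r mxE -mulr_natl mulr1 commr_nat.
rewrite exprSr mxE mulr_sumr mulr_suml mulr_sumr; apply: eq_bigr => l _.
rewrite mulrA IHk -signr_odd -[in RHS]signr_odd !mulr_sign /=.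
by case: odd; rewrite /= ?mulNr -!mulrA yY mulrN ?opprK ?mulNr.
Qed.

Let Y_anti i j p r : Y i j * Y p r = - (Y p r * Y i j).
Proof.
rewrite !YE !mulr_suml -sumrN.
under eq_bigr do rewrite mulr_sumr.
rewrite exchange_big; apply: eq_bigr => k _ /=.
rewrite mulr_sumr -sumrN; apply: eq_bigr => l _.
by rewrite !mulrzAl !mulrzAr e_anti !mulNrz -!mulrzA mulrC.
Qed.

(** Splitting off one factor [Y] leaves an odd power, whose entries anticommute with those of [Y];
    cyclicity of the trace then equates it with its opposite. *)
Lemma tr_even_pow k : \tr (Y ^+ (2 * k.+1)) = 0.
Proof.
have -> : (2 * k.+1 = (2 * k).+2)%N by lia.
apply: (tfL (n := 1)); apply/eqP; rewrite mulr2n addr_eq0; apply/eqP.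
rewrite [in LHS]exprS [in RHS]exprSr /mxtrace.
under eq_bigr do rewrite mxE.
under [in RHS]eq_bigr do rewrite mxE.
rewrite exchange_big -sumrN; apply: eq_bigr => i _ /=.
rewrite -sumrN; apply: eq_bigr => j _.
rewrite anti_pow_entry; last by move=> *; apply: Y_anti.
by rewrite -signr_odd /= mul2n odd_double expr1 mulN1r.
Qed.

(** The trace criterion needs commutative scalars: the entries of [Y ^+ 2] are integer combinations
    of products [e i * e j], which commute, so they lie in [cent_centre E]. This ring inherits
    torsion-freeness from [L]. *)
Lemma rosset_nilpotent : Y ^+ (2 * n.+1) = 0.
Proof.
pose E x := exists i j, x = e i * e j.
have EC x y : E x -> E y -> x * y = y * x.
  (* Passing two generators produces two signs, which cancel. *)
  have eC i k l : e i * (e k * e l) = e k * e l * e i.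
    rewrite mulrA (e_anti i k) mulNr -[e k * e i * _]mulrA (e_anti i l).
    by rewrite mulrN opprK mulrA.
  move=> [i [j ->]] [k [l ->]].
  by rewrite -mulrA eC mulrA eC -mulrA.
have YYC i j : (Y ^+ 2) i j \in centralizer_centre E.
  rewrite expr2 mxE rpred_sum // => k _; rewrite !YE mulr_suml.
  rewrite rpred_sum // => l _.
  rewrite mulr_sumr rpred_sum // => l' _.
  rewrite mulrzAl mulrzAr; do 2!apply: rpredMz.
  have El : E (e l * e l') by exists l, l'.
  apply/centralizer_centreP; split=> [y|y yE]; first exact: EC.
  by rewrite yE.
pose N : 'M[cent_centre E]_n.+1 := \matrix_(i, j) CentCentre (YYC i j).
pose v : {rmorphism cent_centre E -> L} := val.
have NE k : map_mx v (N ^+ k) = Y ^+ (2 * k).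
  rewrite rmorphXn exprM; congr (_ ^+ _).
  by apply/matrixP => i j; rewrite !mxE.
have tfC : torsion_free (cent_centre E).
  move=> x k /(congr1 v); rewrite rmorphMn rmorph0 => /tfL x0.
  by apply: val_inj; rewrite x0 rmorph0.
have trN k : \tr (N ^+ k.+1) = 0.
  by apply: val_inj; rewrite -[LHS]/(v _) -trace_map_mx NE tr_even_pow.
by rewrite -NE (nilpotent_of_tr0 tfC trN) raddf0.
Qed.

End Rosset.

(** Each integer entry of the standard sum annihilates the nonzero product of the [e k], and [L] is
    torsion-free. *)
Lemma amitsur_levitzki_int (n : nat) (A : 'I_(2 * n.+1) -> 'M[int]_n.+1) :
  standard_sum A = 0.
Proof.
have [L [e [tfL e_anti e0]]] := grassmann_exists (2 * n.+1).
have := rosset_pow A tfL e_anti; rewrite rosset_nilpotent // => /esym/matrixP S0.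
apply/matrixP => i j; move: {S0}(S0 i j).
rewrite mxE (bigD1 j) //= [X in _ + X]big1 ?addr0 => [|l lj]; last first.
  by rewrite !mxE (negPf lj) mulr0.
rewrite !mxE eqxx mulr1n mulrzl; exact: torsion_free_mulrz.
Qed.

Lemma standard_sum_multilinear (R : nzRingType) (m : nat) (P : finType)
    (X : 'I_m -> P -> R) :
  standard_sum (fun k => \sum_p X k p) =
  \sum_(f : {ffun 'I_m -> P}) standard_sum (fun k => X k (f k)).
Proof.
rewrite /standard_sum exchange_big /=; apply: eq_bigr => s _.
rewrite -mulr_sumr bigA_distr_bigA /=; congr (_ * _).
(* Composing [f] with [s] attaches each choice to an argument instead of a place in the product, so
   that one [f] serves all [s]. *)
rewrite (reindex (fun f : {ffun 'I_m -> P} => [ffun k => f (s k)])) /=.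
  by apply: eq_bigr => f _; apply: eq_bigr => i _; rewrite ffunE.
exists (fun f : {ffun 'I_m -> P} => [ffun k => f (s^-1%g k)]) => f _;
  by apply/ffunP => k; rewrite !ffunE ?permK ?permKV.
Qed.

Lemma standard_sumZ (R : comNzRingType) (B : algType R) (m : nat)
    (c : 'I_m -> R) (y : 'I_m -> B) :
  standard_sum (fun k => c k *: y k) = (\prod_k c k) *: standard_sum y.
Proof.
rewrite /standard_sum scaler_sumr; apply: eq_bigr => s _.
rewrite scaler_prod scalerAr; congr (_ * (_ *: _)).
by rewrite [RHS](reindex_inj (@perm_inj _ s)).
Qed.

Theorem amitsur_levitzki (R : comNzRingType) (n : nat)
    (A : 'I_(2 * n.+1) -> 'M[R]_n.+1) :
  standard_sum A = 0.
Proof.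
have -> : standard_sum A = standard_sum (fun k =>
    \sum_(p : 'I_n.+1 * 'I_n.+1) A k p.1 p.2 *: delta_mx p.1 p.2).
  by congr standard_sum; apply/funext => k;
    rewrite [LHS]matrix_sum_delta pair_bigA.
rewrite standard_sum_multilinear big1 // => f _.
rewrite (@standard_sumZ R) -[X in _ *: X]/(standard_sum _).
suff -> : standard_sum (fun k => delta_mx (f k).1 (f k).2 : 'M[R]_n.+1) = 0.
  by rewrite scaler0.
have -> : (fun k => delta_mx (f k).1 (f k).2 : 'M[R]_n.+1) =
    (fun k => map_mx intr (delta_mx (f k).1 (f k).2 : 'M[int]_n.+1)).
  by apply/funext => k; rewrite map_delta_mx.
by rewrite standard_sum_morph amitsur_levitzki_int raddf0.
Qed.

(** * The standard identity of F_(q) *)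

Lemma fevalE (F : fieldType) (I : choiceType) (A : algType F) (u : I -> A)
    (f : {freealg F[I]}) :
  feval u f = \sum_(m <- msupp f) f@_m *: word_eval u m.
Proof.
rewrite [LHS]mmapE; apply: eq_bigr => m _.
by rewrite -scalerAl mul1r.
Qed.

Lemma feval_comp (F : fieldType) (I : choiceType) (A B : algType F)
    (phi : {lrmorphism A -> B}) (u : I -> A) (f : {freealg F[I]}) :
  feval (fun i => phi (u i)) f = phi (feval u f).
Proof.
rewrite !fevalE linear_sum; apply: eq_bigr => m _.
by rewrite linearZ /= /word_eval rmorph_prod.
Qed.

Lemma feval_standard (F : fieldType) (A : algType F) (m : nat) (u : 'I_m -> A) :
  feval u (standard_poly m) = standard_sum u.
Proof.
rewrite /standard_poly raddf_sum; apply: eq_bigr => s _.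
rewrite /= [LHS](feval_is_scalable u) scaler_sign mulr_sign.
have -> : feval u (\prod_i fvar (s i)) = \prod_i u (s i) => //.
by rewrite rmorph_prod; apply: eq_bigr => i _; apply: feval_fvar.
Qed.

Lemma malgUE (F : fieldType) (I : choiceType) (c : F) (m : {fmonom I}) :
  << c *g m >> = c *: \prod_(i <- fmonom_val m) fvar i :> {freealg F[I]}.
Proof.
have -> : << c *g m >> = c *: << m >> :> {freealg F[I]}.
  by apply/malgP => k; rewrite mcoeffZ !mcoeffU mulr_natr.
congr (_ *: _); case: m => s /=; elim: s => [|i s IHs].
  rewrite big_nil -fmoneE; exact: erefl.
rewrite big_cons -IHs /fvar malgM_def fgmulUU mulr1; congr << _ >>.
by apply/eqP; rewrite fmP fmM fmU.
Qed.

Section RadfordRelations.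
Variables (F : fieldType) (q : F).
Hypothesis q0 : q != 0.

Definition radford_relations (A : algType F) (u : radford_gen -> A) :=
  [/\ u Gen_a * u Gen_ainv = 1, u Gen_ainv * u Gen_a = 1
    & u Gen_a * u Gen_x = q *: (u Gen_x * u Gen_a)].

Lemma radford_relations_pi :
  radford_relations (fun g => radford_pi q (fvar g)).
Proof.
by split; [exact: radford_aV | exact: radford_Va | exact: radford_ax].
Qed.

Definition commutation_factor (g h : radford_gen) : F :=
  match g, h with
  | Gen_a, Gen_x | Gen_x, Gen_ainv => q
  | Gen_x, Gen_a | Gen_ainv, Gen_x => q^-1
  | _, _ => 1
  end.

Lemma radford_gen_commute (A : algType F) (u : radford_gen -> A) g h :
    radford_relations u ->
  u g * u h = commutation_factor g h *: (u h * u g).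
Proof.
case=> aV Va ax.
have xa : u Gen_x * u Gen_a = q^-1 *: (u Gen_a * u Gen_x).
  by rewrite ax scalerA mulVf ?scale1r.
have Vx : u Gen_ainv * u Gen_x = q^-1 *: (u Gen_x * u Gen_ainv).
  rewrite -[X in _ * X]mulr1 -aV [u Gen_x * _]mulrA xa.
  by rewrite -!(scalerAl, scalerAr) !mulrA Va mul1r.
have xV : u Gen_x * u Gen_ainv = q *: (u Gen_ainv * u Gen_x).
  by rewrite Vx scalerA mulfV ?scale1r.
by case: g; case: h; rewrite /= ?scale1r ?aV ?Va.
Qed.

Lemma radford_seq_commute (A : algType F) (u : radford_gen -> A)
    (r s : seq radford_gen) :
    radford_relations u ->
  (\prod_(g <- r) u g) * \prod_(h <- s) u h =
  (\prod_(g <- r) \prod_(h <- s) commutation_factor g h) *: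
    ((\prod_(h <- s) u h) * \prod_(g <- r) u g).
Proof.
move=> uP.
have gs g : u g * (\prod_(h <- s) u h) =
    (\prod_(h <- s) commutation_factor g h) *: ((\prod_(h <- s) u h) * u g).
  elim: s => [|h s IHs]; first by rewrite !big_nil mul1r mulr1 scale1r.
  rewrite !big_cons mulrA (radford_gen_commute _ _ uP) -scalerAl.
  rewrite -[u h * u g * _]mulrA IHs.
  by rewrite -scalerAr scalerA mulrA.
elim: r => [|g r IHr]; first by rewrite !big_nil mul1r mulr1 scale1r.
rewrite !big_cons -[u g * _ * _]mulrA IHr -scalerAr [u g * (_ * _)]mulrA gs.
by rewrite -scalerAl scalerA mulrC !mulrA.
Qed.

(** The scalar is chosen before [A] and [u]: the same [c] serves [radford q] and its matrix
    representations, which allows it to be computed in the latter. *)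
Lemma radford_seq_perm (r s : seq radford_gen) :
    perm_eq r s ->
  exists c : F, forall (A : algType F) (u : radford_gen -> A),
    radford_relations u -> \prod_(g <- r) u g = c *: \prod_(g <- s) u g.
Proof.
move=> rs; pose P s := exists c : F,
  forall (A : algType F) (u : radford_gen -> A),
    radford_relations u -> \prod_(g <- r) u g = c *: \prod_(g <- s) u g.
(* Permutations are reached by exchanging adjacent blocks, each exchange multiplying the scalar. *)
apply: (@catCA_perm_ind _ P _ _ _ rs); last by exists 1 => A u _; rewrite scale1r.
move=> s1 s2 s3 [c rc].
exists (c * \prod_(g <- s1) \prod_(h <- s2) commutation_factor g h) => A u uP.
rewrite (rc _ _ uP) !big_cat /= mulrA (radford_seq_commute _ _ uP).
by rewrite -scalerAl scalerA !mulrA.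
Qed.

(** Negative powers make [a x = q x a] hold for [x] on the superdiagonal. *)
Definition clock (n : nat) : 'M[F]_n.+1 := diag_mx (\row_i (q^-1) ^+ i).
Definition clock_inv (n : nat) : 'M[F]_n.+1 := diag_mx (\row_i q ^+ i).

Lemma clockV n : clock n * clock_inv n = 1.
Proof.
rewrite [LHS]mulmx_diag -[RHS]diag_const_mx; congr diag_mx; apply/rowP => i.
by rewrite !mxE -exprMn mulVf ?expr1n.
Qed.

Lemma clock_invV n : clock_inv n * clock n = 1.
Proof.
rewrite [LHS]mulmx_diag -[RHS]diag_const_mx; congr diag_mx; apply/rowP => i.
by rewrite !mxE -exprMn mulfV ?expr1n.
Qed.

Definition clock_rep n (X : 'M[F]_n.+1) (g : radford_gen) : 'M[F]_n.+1 :=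
  match g with Gen_a => clock n | Gen_ainv => clock_inv n | Gen_x => X end.

(** Entrywise comparison of [a x] with [q x a]. The criterion covers both the cyclic shift and the
    nilpotent shift. *)
Lemma clock_rep_relations n (X : 'M[F]_n.+1) :
    (forall i j, X i j != 0 -> (q^-1) ^+ i = q * (q^-1) ^+ j) ->
  radford_relations (clock_rep X).
Proof.
move=> XE; split; rewrite /= ?clockV ?clock_invV //.
rewrite -[_ * _]/(_ *m _) -[X * _]/(_ *m _); apply/matrixP => i j.
rewrite mul_diag_mx mul_mx_diag !mxE.
have [->|/XE ->] := eqVneq (X i j) 0; first by rewrite mul0r !mulr0.
by rewrite -mulrA; congr (_ * _); rewrite mulrC.
Qed.

(** Each [y k] is lifted to the free algebra; the union of the supports gives a single finite family
    of words for all [k], as the multilinear expansion requires. *)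
Lemma radford_word_span m (y : 'I_m -> radford q) :
  exists (P : finType) (w : P -> seq radford_gen) (c : 'I_m -> P -> F),
    forall k, y k = \sum_p c k p *: \prod_(g <- w p) radford_pi q (fvar g).
Proof.
have /choice [f fy] : forall k, exists f, radford_pi q f = y k.
  by move=> k; apply: radford_pi_surj.
pose D := (\bigcup_(k <- enum 'I_m) msupp (f k))%fset.
exists D, (fun p => fmonom_val (val p)), (fun k p => (f k)@_(val p)) => k.
have fkD : (msupp (f k) `<=` D)%fset.
  by apply: bigfcup_sup; rewrite ?mem_enum.
rewrite -fy [in LHS](monalgEw fkD) raddf_sum big_seq_fsetE.
apply: eq_bigr => p _ /=.
by rewrite malgUE linearZ /= rmorph_prod.
Qed.

Lemma radford_standard n : n.+1.-primitive_root q ->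
  polynomial_identity (radford q) (standard_poly (2 * n.+1)).
Proof.
move=> q_prim y; rewrite feval_standard.
have [P [w [c yE]]] := radford_word_span y.
have -> : y = (fun k => \sum_p c k p *: \prod_(g <- w p) radford_pi q (fvar g)).
  exact/funext.
rewrite standard_sum_multilinear big1 // => f _; rewrite standard_sumZ.
set u := fun g => radford_pi q (fvar g).
suff -> : standard_sum (fun k => \prod_(g <- w (f k)) u g) = 0 by rewrite scaler0.
pose ww (s : 'S_(2 * n.+1)) :=
  flatten [seq w (f (s k)) | k <- index_enum 'I_(2 * n.+1)].
have wwE (A : algType F) (v : radford_gen -> A) (s : 'S_(2 * n.+1)) :
    \prod_k \prod_(g <- w (f (s k))) v g = \prod_(g <- ww s) v g.
  by rewrite big_flatten big_map.
have /choice [d dE] : forall s : 'S_(2 * n.+1), exists c : F,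
    forall (A : algType F) (v : radford_gen -> A),
    radford_relations v -> \prod_(g <- ww s) v g = c *: \prod_(g <- ww 1%g) v g.
  move=> s; apply: radford_seq_perm; apply: perm_flatten.
  have -> : [seq w (f ((1%g : 'S_(2 * n.+1)) k)) | k <- index_enum 'I_(2 * n.+1)] =
      map (w \o f) (index_enum 'I_(2 * n.+1)).
    by apply: eq_map => k; rewrite perm1.
  rewrite (map_comp (w \o f) s); apply: perm_map; apply: uniq_perm.
  - by rewrite map_inj_uniq ?index_enum_uniq //; apply: perm_inj.
  - exact: index_enum_uniq.
  - move=> k; rewrite mem_index_enum; apply/mapP; exists (s^-1 k)%g.
      by rewrite mem_index_enum.
    by rewrite permKV.
have sumE (A : algType F) (v : radford_gen -> A) : radford_relations v ->
    standard_sum (fun k => \prod_(g <- w (f k)) v g) =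
    (\sum_(s : 'S_(2 * n.+1)) (-1) ^+ s * d s) *: \prod_(g <- ww 1%g) v g.
  move=> vP; rewrite /standard_sum scaler_suml; apply: eq_bigr => s _.
  by rewrite wwE (dE _ _ _ vP) !mulr_sign; case: odd_perm; rewrite // scaleNr.
rewrite sumE; last exact: radford_relations_pi.
(* The cyclic shift: its wrap-around entry is compatible with the relations because [q ^+ n.+1 = 1],
   and it is invertible. *)
pose X : 'M[F]_n.+1 := perm_mx (perm (@ordS_inj n.+1)).
have XP : radford_relations (clock_rep X).
  apply: clock_rep_relations => i j; rewrite !mxE permE.
  case: (eqVneq (ordS i) j) => [<- _|_]; last by rewrite eqxx.
  have qVn : q^-1 ^+ n.+1 = 1 by rewrite exprVn prim_expr_order ?invr1.
  by rewrite /= (expr_mod i.+1 qVn) exprS mulrA mulfV // mul1r.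
have W_unit : \prod_(g <- ww 1%g) clock_rep X g \is a GRing.unit.
  apply: rpred_prod => [[]] _; apply/unitrP; rewrite /=.
  - by exists (clock_inv n); rewrite clockV clock_invV.
  - by exists (clock n); rewrite clockV clock_invV.
  - by apply/unitrP; apply: unitmx_perm.
(* On matrices the left side of [sumE] is 0 and the word is a unit, so the scalar shared with
   [radford q] vanishes. *)
have := sumE _ _ XP; rewrite amitsur_levitzki.
move/(congr1 ( *%R^~ (\prod_(g <- ww 1%g) clock_rep X g)^-1)).
rewrite mul0r -scalerAl mulrV // => /esym/eqP.
by rewrite scaler_eq0 oner_eq0 orbF => /eqP->; rewrite scale0r.
Qed.

End RadfordRelations.

(** * Lower bound on the degree *)

(** The sets [T] and [k |: T], for [k] outside [T], cancel in pairs. *)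
Lemma alternating_sum_eq0 (R : nzRingType) (K : finType) (k : K)
    (g : {set K} -> R) :
  (forall T, g (k |: T) = g T) -> \sum_(T : {set K}) (-1) ^+ #|T| * g T = 0.
Proof.
move=> gk; rewrite (bigID (fun T : {set K} => k \in T)) /=.
rewrite (reindex_onto (fun T => k |: T) (fun T => T :\ k)) /=; last first.
  by move=> T kT; rewrite setD1K.
rewrite (eq_bigl (fun T : {set K} => k \notin T)) => [|T]; last first.
  rewrite setU11 /=; apply/eqP/idP => [<-|kT]; first by rewrite setD11.
  by rewrite setU1K.
rewrite -big_split big1 //= => T kT.
by rewrite cardsU1 kT gk exprS mulN1r mulNr addNr.
Qed.

Section AlternatingSubstitution.
Variables (F : fieldType) (A : algType F) (t : nat -> A).
Variables (I : choiceType) (w : {fmonom I}).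
Local Notation d := (size (fmonom_val w)).
Hypothesis t_rigid : forall s, perm_eq s (iota 0 d) ->
  \prod_(k <- s) t k != 0 -> s = iota 0 d.

Let letter (k : 'I_d) := tnth (in_tuple (fmonom_val w)) k.

Definition subst_sum (T : {set 'I_d}) (i : I) : A :=
  \sum_(k | (k \in T) && (letter k == i)) t k.

(** Inclusion-exclusion: expanding [v] gives maps [f] from positions of [v] to positions of [w], and
    the alternating sum keeps only surjective ones. As [v] is no longer than [w], these are
    bijections, and rigidity leaves the identity, which forces [v = w]. *)
Lemma alternating_word_eval (v : {fmonom I}) : (size (fmonom_val v) <= d)%N ->
  \sum_(T : {set 'I_d}) (-1) ^+ #|T| * word_eval (subst_sum T) v =
  (-1) ^+ d * (\prod_(k <- iota 0 d) t k) *+ (v == w).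
Proof.
set e := size (fmonom_val v) => le_ed.
pose lv (l : 'I_e) := tnth (in_tuple (fmonom_val v)) l.
pose term (T : {set 'I_d}) (f : {ffun 'I_e -> 'I_d}) : A :=
  \prod_l (if (f l \in T) && (letter (f l) == lv l) then t (f l) else 0).
have -> : \sum_(T : {set 'I_d}) (-1) ^+ #|T| * word_eval (subst_sum T) v =
    \sum_(f : {ffun 'I_e -> 'I_d}) \sum_(T : {set 'I_d}) (-1) ^+ #|T| * term T f.
  rewrite exchange_big; apply: eq_bigr => T _ /=; rewrite -mulr_sumr.
  congr (_ * _); rewrite /word_eval big_tnth.
  under eq_bigr do rewrite /subst_sum big_mkcond.
  by rewrite bigA_distr_bigA.
have term0 f : term setT f != 0 -> (forall k, exists l, f l = k) ->
    v = w /\ forall l, val (f l) = val l.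
  move=> tf0 f_onto; pose s := [seq val (f l) | l <- enum 'I_e].
  have iota_s : {subset iota 0 d <= s}.
    move=> k; rewrite mem_iota add0n => /= kd;
    have [l fl] := f_onto (Ordinal kd).
    by apply/mapP; exists l; rewrite ?mem_enum // fl.
  have size_s : size s = e by rewrite size_map size_enum_ord.
  have s_iota : perm_eq s (iota 0 d).
    have Us : uniq s.
      by apply: leq_size_uniq iota_s _; rewrite ?iota_uniq // size_s size_iota.
    apply: uniq_perm; rewrite ?iota_uniq // => k.
    by have [] := uniq_min_size (iota_uniq 0 d) iota_s;
       rewrite ?size_s ?size_iota // => _ ->.
  have de : d = e by rewrite -size_s (perm_size s_iota) size_iota.
  have letters l : letter (f l) = lv l.
    apply/eqP; apply: contraNT tf0 => fl; apply/eqP.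
    rewrite /term [index_enum _]unlock -enumT.
    have : l \in enum 'I_e by rewrite mem_enum.
    case/splitPr => r1 r2; rewrite big_cat big_cons /= (negPf fl) andbF.
    by rewrite mul0r mulr0.
  have sE : s = iota 0 d.
    apply: t_rigid => //; rewrite big_map enumT; apply: contraNneq tf0.
    rewrite /term [index_enum _]unlock => <-; apply/eqP/eq_bigr => l _.
    by rewrite inE letters eqxx.
  have fE l : val (f l) = val l.
    have : s = map val (enum 'I_e) by rewrite sE val_enum_ord de.
    by move/eq_in_map; apply; rewrite mem_enum.
  split=> //; apply/eqP; rewrite fmP; apply/eqP.
  have szE : size (fmonom_val v) = size (fmonom_val w) by rewrite de.
  case Ev: (fmonom_val v) => [|i0 v']; rewrite -?Ev.
    by move: szE; rewrite Ev => /esym/size0nil.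
  apply: (@eq_from_nth _ i0) => // l le_l.
  have := letters (Ordinal le_l); rewrite /letter /lv !(tnth_nth i0) /= fE.
  by move=> ->.
have term_sum f : \sum_(T : {set 'I_d}) (-1) ^+ #|T| * term T f = (-1) ^+ d *
    (if [forall k, exists l, f l == k] then term setT f else 0).
  case: ifPn => [/forallP f_onto|].
    rewrite (bigD1 setT) //= cardsT card_ord big1 ?addr0 // => T.
    (* Any other [T] omits a value of the surjective [f], which makes a factor 0. *)
    rewrite eqEsubset subsetT /= => /subsetPn[k _ kT].
    have /existsP[l /eqP fl] := f_onto k.
    suff -> : term T f = 0 by rewrite mulr0.
    rewrite /term [index_enum _]unlock -enumT.
    have : l \in enum 'I_e by rewrite mem_enum.
    case/splitPr => r1 r2; rewrite big_cat big_cons /= fl (negPf kT).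
    by rewrite mul0r mulr0.
  rewrite negb_forall mulr0 => /existsP[k]; rewrite negb_exists => /forallP fk.
  (* Since [f] misses [k], the term is the same whether or not [k] belongs to [T]. *)
  apply: (@alternating_sum_eq0 _ _ k) => T; apply: eq_bigr => l _.
  by rewrite !inE (negPf (fk l)).
rewrite (eq_bigr _ (fun f _ => term_sum f)).
rewrite -mulr_sumr -mulrnAr; congr (_ * _).
have [vw|vw] := eqVneq v w; last first.
  rewrite mulr0n big1 // => f _; case: ifP => // /forallP f_onto.
  have [//|/term0 fE] := eqVneq (term setT f) 0.
  suff [/eqP] : v = w /\ forall l, val (f l) = val l by rewrite (negPf vw).
  by apply: fE => k; have /existsP[l /eqP] := f_onto k; exists l.
have ed : e = size (fmonom_val w) by rewrite /e vw.
pose f0 : {ffun 'I_e -> _} := [ffun l => cast_ord ed l].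
rewrite (bigD1 f0) //= [X in _ + X]big1 ?addr0 => [|f f_neq].
  have -> : [forall k, exists l, f0 l == k].
    apply/forallP => k; apply/existsP; exists (cast_ord (esym ed) k).
    by rewrite ffunE cast_ordKV.
  have -> : iota 0 d = map val (enum 'I_e) by rewrite val_enum_ord ed.
  rewrite mulr1n /term big_map enumT [index_enum _]unlock.
  apply: eq_bigr => l _; rewrite inE ffunE /=.
  suff -> : letter (cast_ord ed l) = lv l by rewrite eqxx.
  (* This letter only serves as the default value of [nth]. *)
  have i0 := lv l.
  by rewrite /letter /lv !(tnth_nth i0) /= -vw.
case: ifP => // /forallP f_onto.
have [//|/term0 fE] := eqVneq (term setT f) 0.
case/eqP: f_neq; apply/ffunP => l; apply: val_inj; rewrite ffunE /=.
have [|_ -> //] := fE.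
by move=> k; have /existsP[l' /eqP] := f_onto k; exists l'.
Qed.

End AlternatingSubstitution.

Section Staircase.
Variables (F : fieldType) (n : nat).

(* Indexed from 0: E_00, E_01, E_11, E_12, ... (meaningful for k <= 2n only). *)
Definition stair (k : nat) : 'M[F]_n.+1 :=
  delta_mx (inord k./2) (inord (uphalf k)).

(** Matrix units multiply to a matrix unit or to 0; the bound [n.*2] keeps all indices at most [n],
    where [inord] is faithful. *)
Lemma stair_prod k r : all (fun j => j <= n.*2)%N (k :: r) ->
  \prod_(j <- k :: r) stair j =
  (path (fun i j => uphalf i == j./2) k r)%:R *:
    delta_mx (inord k./2) (inord (uphalf (last k r))).
Proof.
elim: r k => [|l r IHr] k /=; first by rewrite big_seq1 scale1r.
case/and3P=> kn ln rn; rewrite big_cons IHr /= ?ln //.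
rewrite -scalerAr [stair k * _]mul_delta_mx_cond.
have -> : (inord (uphalf k) == inord l./2 :> 'I_n.+1) = (uphalf k == l./2).
  by rewrite -val_eqE /= !inordK //; lia.
by case: eqP => _ /=; rewrite ?mulr1n // mulr0n scaler0 scale0r.
Qed.

(** If [uphalf k = l./2] and [k] differs from [l], then [k < l]. A nonzero product of distinct
    factors is therefore in increasing order. *)
Lemma stair_rigid d s : (d <= n.*2.+1)%N -> perm_eq s (iota 0 d) ->
  \prod_(k <- s) stair k != 0 -> s = iota 0 d.
Proof.
move=> dn s_iota s_neq0.
have s_le : all (fun j => j <= n.*2)%N s.
  by apply/allP => j; rewrite (perm_mem s_iota) mem_iota; lia.
have s_uniq : uniq s by rewrite (perm_uniq s_iota) iota_uniq.
suff s_sorted : sorted ltn s.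
  apply: (irr_sorted_eq ltn_trans ltnn) => //; first exact: iota_ltn_sorted.
  exact: perm_mem.
case: s s_le s_uniq s_neq0 {s_iota} => // k r s_le s_uniq.
rewrite stair_prod //; case: (boolP (path _ _ _)) => [kr _|_]; last first.
  by rewrite scale0r eqxx.
elim: r k s_uniq kr {s_le} => //= l r IHr k.
rewrite inE negb_or => /and3P[/andP[kl _] lr r_uniq] /andP[/eqP k_l l_r].
apply/andP; split; last by apply: IHr => //=; rewrite lr.
move: kl k_l => /eqP; lia.
Qed.

(** Consecutive factors compose because [uphalf k] equals [k.+1./2]. *)
Lemma stair_iota_neq0 d : (d <= n.*2.+1)%N ->
  \prod_(k <- iota 0 d) stair k != 0.
Proof.
case: d => [|d] dn; first by rewrite big_nil oner_eq0.
rewrite stair_prod; last first.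
  by apply/allP => j; rewrite -[_ :: _]/(iota 0 d.+1) mem_iota; lia.
have -> : path (fun i j => uphalf i == j./2) 0%N (iota 1 d).
  by elim: d 0%N {dn} => //= d IHd k; rewrite IHd andbT; lia.
rewrite scale1r; apply/eqP => /matrixP/(_ _ _)/eqP.
move/(_ (inord 0./2) (inord (uphalf (last 0%N (iota 1 d))))).
by rewrite !mxE !eqxx oner_eq0.
Qed.

End Staircase.

(** * Universal property of [F_(q)] *)

Section RadfordLift.
Variables (F : fieldType) (q : F) (A : algType F) (u : radford_gen -> A).

(* The relations are a phantom argument, on which the morphism instances below
   are keyed. *)
Definition radford_lift of radford_relations q u : radford q -> A :=
  fun y => feval u (repr y).

Hypothesis uP : radford_relations q u.

Lemma radford_lift_pi f : radford_lift uP (radford_pi q f) = feval u f.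
Proof.
case: uP => aV Va ax.
have := feval_radford_ideal aV Va ax (radford_repr q f).
by rewrite fevalB => /eqP; rewrite subr_eq0 => /eqP->.
Qed.

Lemma radford_lift_zmod_morphism : zmod_morphism (radford_lift uP).
Proof.
move=> y z; have [f <-] := radford_pi_surj y; have [g <-] := radford_pi_surj z.
by rewrite -rmorphB !radford_lift_pi fevalB.
Qed.

HB.instance Definition _ := GRing.isZmodMorphism.Build (radford q) A
  (radford_lift uP) radford_lift_zmod_morphism.

Lemma radford_lift_monoid_morphism : monoid_morphism (radford_lift uP).
Proof.
split=> [|y z]; first by rewrite -(rmorph1 (radford_pi q)) radford_lift_pi feval1.
have [f <-] := radford_pi_surj y; have [g <-] := radford_pi_surj z.
by rewrite -rmorphM !radford_lift_pi fevalM.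
Qed.

HB.instance Definition _ := GRing.isMonoidMorphism.Build (radford q) A
  (radford_lift uP) radford_lift_monoid_morphism.

Lemma radford_lift_scalable : scalable (radford_lift uP).
Proof.
move=> c y; have [f <-] := radford_pi_surj y.
by rewrite -linearZ !radford_lift_pi [LHS](feval_is_scalable u).
Qed.

HB.instance Definition _ := GRing.isScalable.Build F (radford q) A *:%R
  (radford_lift uP) radford_lift_scalable.

Lemma radford_lift_gen g : radford_lift uP (radford_pi q (fvar g)) = u g.
Proof. by rewrite radford_lift_pi feval_fvar. Qed.

End RadfordLift.

Section LowerBound.
Variables (F : fieldType) (q : F) (n : nat).
Hypothesis q0 : q != 0.
Hypothesis q_distinct : forall i j, (i < j <= n)%N -> q ^+ i != q ^+ j.

Definition nilshift : 'M[F]_n.+1 := \matrix_(i, j) (i.+1 == j :> nat)%:R.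

(** Without a wrap-around entry, the relations impose no condition on the order of [q]. *)
Lemma nilshift_relations : radford_relations q (clock_rep q nilshift).
Proof.
apply: clock_rep_relations => // i j; rewrite mxE.
case: (eqVneq i.+1 (j : nat)) => [<- _|_]; last by rewrite eqxx.
by rewrite exprS mulrA mulfV // mul1r.
Qed.

Let phi : {lrmorphism radford q -> 'M[F]_n.+1} :=
  radford_lift nilshift_relations.

Lemma clock_idempotent (i : 'I_n.+1) : exists y, phi y = delta_mx i i.
Proof.
pose r j : F := q^-1 ^+ j.
have r_neq (j : 'I_n.+1) : j != i -> r i - r j != 0.
  move=> ji; rewrite subr_eq0 /r !exprVn (inj_eq invr_inj).
  have [ij|ij|/val_inj ij] := ltngtP i j.
  - by apply: q_distinct; rewrite ij leq_ord.
  - by rewrite eq_sym; apply: q_distinct; rewrite ij leq_ord.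
  - by rewrite ij eqxx in ji.
(* Lagrange interpolation at the distinct diagonal entries of the clock. *)
exists (\prod_(j < n.+1 | j != i)
   ((r i - r j)^-1 *: (radford_a q - r j *: 1))).
rewrite rmorph_prod /=.
have E (s : seq 'I_n.+1) :
    \prod_(j <- s | j != i) phi ((r i - r j)^-1 *: (radford_a q - r j *: 1)) =
    diag_mx (\row_k \prod_(j <- s | j != i) ((r i - r j)^-1 * (r k - r j))).
  elim: s => [|j s IHs].
    rewrite big_nil -[LHS]diag_const_mx; congr diag_mx; apply/rowP => k.
    by rewrite !mxE big_nil.
  rewrite big_cons {}IHs; case: ifP => ji; last first.
    by congr diag_mx; apply/rowP => k; rewrite !mxE big_cons ji.
  have -> : phi ((r i - r j)^-1 *: (radford_a q - r j *: 1)) =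
      diag_mx (\row_k ((r i - r j)^-1 * (r k - r j))).
    rewrite linearZ linearB linearZ rmorph1 /= radford_lift_gen /=.
    apply/matrixP => k l; rewrite !mxE.
    by case: eqP => [->|_]; rewrite ?mulr1n ?mulr1 // !mulr0n mulr0 subr0 mulr0.
  rewrite [LHS]mulmx_diag; congr diag_mx; apply/rowP => k.
  by rewrite !mxE big_cons ji.
rewrite E; apply/matrixP => k l; rewrite !mxE.
have [<-|kl] := eqVneq k l; last first.
  by rewrite mulr0n; case: eqP => //= <-; rewrite eq_sym (negPf kl).
have [->|ki] := eqVneq k i.
  by rewrite mulr1n big1 // => j ji; rewrite mulVf ?r_neq.
by rewrite mulr1n (bigD1 k) //= subrr mulr0 mul0r.
Qed.

Lemma stair_lift k : (k <= n.*2)%N -> exists y, phi y = stair F n k.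
Proof.
move=> kn; have [y yE] := clock_idempotent (inord k./2).
have [k_odd|k_even] := boolP (odd k); last first.
  exists y; rewrite yE /stair; congr (delta_mx _ (inord _)); lia.
(* [E_ii] times the shift is [E_(i,i+1)]; an odd [k] up to [n.*2] has [k./2 < n], so this row of the
   shift is nonzero. *)
exists (y * radford_x q); rewrite rmorphM /= yE radford_lift_gen /=.
apply/matrixP => i j; rewrite mxE (bigD1 (inord k./2)) //= big1 ?addr0.
  rewrite !mxE eqxx andbT /= -val_eqE /= -[X in _ = (_ && X)%:R]val_eqE /=.
  rewrite !inordK; try lia.
  have -> : uphalf k = (k./2).+1 by lia.
  by rewrite eq_sym [j == _ :> nat]eq_sym; do 2!case: eqP => _; rewrite ?mulr1 ?mulr0.
by move=> l li; rewrite !mxE (negPf li) andbF mul0r.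
Qed.

(** Distinctness of the first [n.+1] powers is the common hypothesis for [q] of order [n.+1] and,
    with [n] arbitrary, for [q] of infinite order. *)
Lemma nontrivial_PI_degree (I : choiceType) (f : {freealg F[I]}) :
  nontrivial_PI (radford q) f -> (n.*2.+1 < fdegree f)%N.
Proof.
case=> f0 fPI; rewrite ltnNge; apply/negP => f_le.
(* A word of maximal degree: [mmeasure] is positive since [f] is nonzero, and it is the maximum of
   the [(fdeg v).+1]. *)
have [w wf w_deg] : exists2 w, w \in msupp f & fdegree f = fdeg w.
  have m_gt0 : (0 < mmeasure (@fdeg I) f)%N by rewrite lt0n mmeasure_eq0.
  apply: contrapT => no_w; suff : (mmeasure (@fdeg I) f <= fdegree f)%N.
    by rewrite /fdegree; lia.
  rewrite {1}mmeasureE; apply/bigmax_leqP_seq => v vf _; rewrite ltn_neqAle.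
  have := mmeasure_mnm_lt (@fdeg I) vf; rewrite /fdegree => v_lt.
  apply/andP; split; last by rewrite -ltnS prednK.
  by apply/eqP => v_eq; apply: no_w; exists v.
have v_deg v : v \in msupp f -> (fdeg v <= fdeg w)%N.
  move=> vf; have v_lt := mmeasure_mnm_lt (@fdeg I) vf.
  by rewrite -w_deg /fdegree -ltnS prednK //; apply: leq_ltn_trans v_lt.
have /choice [y yE] : forall k, exists y, (k <= n.*2)%N -> phi y = stair F n k.
  move=> k; have [kn|kn] := leqP k n.*2; last by exists 0.
  by have [y yE] := stair_lift kn; exists y.
rewrite w_deg fdegE in f_le.
have sub_eq0 T : feval (subst_sum (stair F n) (w := w) T) f = 0.
  pose z i : radford q :=
    \sum_(k | (k \in T) && (tnth (in_tuple (fmonom_val w)) k == i)) y k.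
  have -> : subst_sum (stair F n) (w := w) T = (fun i => phi (z i)).
    apply/funext => i; rewrite linear_sum; apply: eq_bigr => k _.
    by apply/esym/yE; have := ltn_ord k; lia.
  by rewrite feval_comp fPI raddf0.
(* The same sum is next evaluated word by word, where only [w] contributes. *)
have : \sum_(T : {set 'I_(size (fmonom_val w))}) (-1) ^+ #|T| *
    feval (subst_sum (stair F n) (w := w) T) f = 0.
  by rewrite big1 // => T _; rewrite sub_eq0 mulr0.
under eq_bigr do rewrite fevalE mulr_sumr.
rewrite exchange_big /=.
rewrite (eq_big_seq (fun v => f@_v *: ((-1) ^+ (size (fmonom_val w)) *
   (\prod_(k <- iota 0 (size (fmonom_val w))) stair F n k) *+ (v == w))))
  /=; last first.
  move=> v vf; rewrite -alternating_word_eval; [| |exact: v_deg].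
    by rewrite scaler_sumr; apply: eq_bigr => T _; rewrite scalerAr.
  by move=> s; apply: stair_rigid.
rewrite (big_fsetD1 w) //= eqxx mulr1n [X in _ + X]big1_fset ?addr0 => [|v];
  last first.
  by rewrite !inE => /andP[/negPf->]; rewrite mulr0n scaler0.
rewrite -mcoeff_neq0 in wf.
move/eqP; rewrite -signr_odd mulr_sign scaler_eq0 (negPf wf).
by case: odd; rewrite ?oppr_eq0 (negPf (stair_iota_neq0 _ f_le)).
Qed.

End LowerBound.

(** * Nonvanishing and degree of the standard polynomial *)

Lemma standard_polyE (F : fieldType) m :
  standard_poly m = \sum_(s : 'S_m) (-1) ^+ s *:
    << fmonom_of_seq fmonom_key [seq s i | i <- enum 'I_m] >> :> {freealg F['I_m]}.
Proof.
apply: eq_bigr => s _; congr (_ *: _); rewrite fmE malgUE scale1r /=.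
rewrite big_map enumT [index_enum _]unlock; exact: erefl.
Qed.

(** Distinct permutations give distinct words, so only the identity contributes to this monomial. *)
Lemma standard_poly_coef1 (F : fieldType) m :
  (standard_poly m : {freealg F['I_m]})@_(fmonom_of_seq fmonom_key (enum 'I_m)) = 1.
Proof.
rewrite standard_polyE raddf_sum (bigD1 1%g) //= [X in _ + X]big1
  ?addr0 => [|s s1].
  rewrite odd_perm1 scale1r (eq_map (g := id)) ?map_id; last first.
    by move=> i; rewrite perm1.
  by rewrite mcoeffUU.
rewrite mcoeffZ mcoeffU; case: eqP; last by rewrite mulr0.
rewrite !fmE => [[]] sE; case/eqP: s1; apply/permP => i; rewrite perm1.
have : [seq s i | i <- enum 'I_m] = [seq i | i <- enum 'I_m] by rewrite sE map_id.
by move/eq_in_map; apply; rewrite mem_enum.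
Qed.

Lemma standard_poly_neq0 (F : fieldType) m :
  standard_poly m != 0 :> {freealg F['I_m]}.
Proof.
apply/eqP => S0; have := standard_poly_coef1 F m; rewrite S0 mcoeff0.
by move/eqP; rewrite eq_sym oner_eq0.
Qed.

Lemma fdegree_standard_poly (F : fieldType) m :
  (fdegree (standard_poly m : {freealg F['I_m]}) <= m)%N.
Proof.
rewrite /fdegree -ltnS prednK ?lt0n ?mmeasure_eq0 ?standard_poly_neq0 //.
rewrite standard_polyE.
apply: leq_trans (mmeasure_sum _ _ _ _) _; apply/bigmax_leqP => s _.
rewrite mmeasureE.
apply/bigmax_leqP_seq => v vs _.
have := fsubsetP (msuppZ_le _ _) _ vs; rewrite msuppU1 in_fset1 => /eqP ->.
rewrite ltnS fmE -[X in (X <= _)%N]/(size [seq s i | i <- enum 'I_m]).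
by rewrite size_map size_enum_ord.
Qed.

Theorem theorem6p2 (F : fieldType) (q : F) (hq : q != 0) :
  (satisfies_nontrivial_PI (radford q) <->
     exists n : nat, (0 < n)%N /\ q ^+ n = 1) /\
  (forall n : nat, n.-primitive_root q ->
     polynomial_identity (radford q) (standard_poly (2 * n)) /\
     min_PI_degree (radford q) (2 * n)).
Proof.
have standard_PI n : n.-primitive_root q ->
    nontrivial_PI (radford q) (standard_poly (2 * n)).
  move=> q_prim; split; first exact: standard_poly_neq0.
  by case: n q_prim => [/prim_order_gt0|n /(radford_standard hq)].
have lower n : n.-primitive_root q -> forall (I : choiceType) (f : {freealg F[I]}),
    nontrivial_PI (radford q) f -> (2 * n <= fdegree f)%N.
  case: n => [/prim_order_gt0//|n] q_prim I f /(nontrivial_PI_degree (n := n) hq).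
  rewrite mul2n doubleS; apply => i j /andP[ij jn].
  rewrite (eq_prim_root_expr q_prim) !modn_small ?ltnS // ?neq_ltn ?ij //.
  exact: leq_trans (ltnW ij) jn.
split; last first.
  move=> n q_prim; have [S0 SI] := standard_PI _ q_prim; split=> //.
  split; last exact: lower.
  (* The degree is at most [2 * n] by the shape of the polynomial, and at least [2 * n] because it
     is a nontrivial identity of [radford q]. *)
  exists 'I_(2 * n), (standard_poly (2 * n)); split=> //; apply/eqP.
  by rewrite eqn_leq fdegree_standard_poly lower.
split=> [[I [f fPI]]|[n [n0 /(prim_order_exists n0)[m q_prim _]]]]; last first.
  by exists 'I_(2 * m), (standard_poly (2 * m)); apply: standard_PI.
apply: contrapT => no_root.
have q_inj i j : (i < j)%N -> q ^+ i != q ^+ j.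
  move=> ij; apply/eqP => qij; apply: no_root; exists (j - i)%N.
  rewrite subn_gt0 ij; split=> //; apply: (mulfI (expf_neq0 i hq)).
  by rewrite mulr1 -exprD subnKC // ltnW.
(* All powers of [q] are distinct, so the degree bound holds for every [n]; taking [n] to be
   [fdegree f] is contradictory. *)
suff : ((fdegree f).*2.+1 < fdegree f)%N by lia.
by apply: nontrivial_PI_degree fPI => // i j /andP[ij _]; apply: q_inj.
Qed.
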